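(* Let $\mathbb{K}$ be a field, $S=\mathbb{K}[x_1,\ldots,x_n]$, and let $I\subseteq S$ be a support-$2$ monomial ideal such that the irreducible decomposition of $I$ is minimal and $I$ has no embedded associated primes. Then $I$ is a Simis ideal if and only if $G(I)$ is a bipartite graph and $I$ has a standard linear weighting. In particular, if such an $I$ is a Simis ideal, then there exist a Simis square-free monomial ideal $J\subseteq S$ and a standard linear weighting $w$ of $S$ such that $I=J_w$.
   Context: For a monomial ideal $I$, $\mathcal{G}(I)$ denotes its unique minimal set of monomial generators. $I$ is a support-$2$ monomial ideal if $\mathcal{G}(I)\subseteq\{x_i^ax_j^b : 1\le i<j\le n,\ a,b\ge 1\}$. The underlying simple graph $G(I)$ has vertices $x_1,\ldots,x_n$ and an edge $\{x_i,x_j\}$ whenever some element of $\mathcal{G}(I)$ has support $\{x_i,x_j\}$; thus $\sqrt{I}$ is the edge ideal $I(G(I))=\langle x_ix_j:\{x_i,x_j\}\in E(G(I))\rangle$. The $s$-th symbolic power is $I^{(s)}=\bigcap_{P\in \mathrm{MinAss}(I)}(I^sS_P\cap S)$, where $\mathrm{MinAss}(I)$ is the set of minimal primes of $I$; for monomial $I$ this equals $\bigcap_{P\in\mathrm{MinAss}(I)}Q(P)^s$ with $Q(P)$ the $P$-primary component of $I$. $I$ is a Simis ideal if $I^{(s)}=I^s$ for all $s\ge1$. An ideal is irreducible if it is not an intersection of two strictly larger ideals; irreducible monomial ideals are those generated by pure powers of variables, and every monomial ideal has a unique irredundant decomposition as an intersection of irreducible monomial ideals. This irreducible decomposition $I=\bigcap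 Q_i$ is called minimal if $\sqrt{Q_i}\neq\sqrt{Q_j}$ for $i\ne j$. A standard linear weighting of $S$ is a map $w:\mathbb{R}^n\to\mathbb{R}^n$, $w(a_1,\ldots,a_n)=(d_1a_1,\ldots,d_na_n)$ for fixed positive integers $d_1,\ldots,d_n$; for a monomial ideal $J$, $J_w$ is the ideal generated by the monomials $\mathbf{x}^{w(\mathbf{a})}$ for $\mathbf{x}^{\mathbf{a}}\in\mathcal{G}(J)$ (i.e., replace each $x_i$ by $x_i^{d_i}$ in the generators). ''$I$ has a standard linear weighting'' means $I=(\sqrt{I})_w$ for some standard linear weighting $w$. *)

(* Defs.v *)
From HB Require Import structures.
From mathcomp Require Import all_boot all_order all_algebra.
From mathcomp Require Import mpoly.
Set Implicit Arguments. Unset Strict Implicit. Unset Printing Implicit Defensive.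
Import GRing.Theory.
Local Open Scope ring_scope.

Section MonomialIdeals.
Variables (K : fieldType) (n : nat).

Local Notation S := {mpoly K[n]}.

(* Subsets of S (ideals are represented by their set of elements). *)
Definition sset := S -> Prop.
Definition seqv (A B : sset) := forall f, A f <-> B f.
Definition ssub (A B : sset) := forall f, A f -> B f.
Definition scap (A B : sset) : sset := fun f => A f /\ B f.

Definition is_ideal (I : sset) :=
  [/\ I 0, (forall f g, I f -> I g -> I (f + g)) & (forall h f, I f -> I (h * f))].

Definition genI (A : sset) : sset := fun f =>
  exists s : seq (S * S), (forall p, p \in s -> A p.2) /\ f = \sum_(p <- s) p.1 * p.2.

Definition mono (m : 'X_{1..n}) : S := 'X_[m].

Definition mdiv (m1 m2 : 'X_{1..n}) := forall i, (m1 i <= m2 i)%N.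

Definition monomial_ideal (I : sset) :=
  seqv I (genI (fun p => I p /\ exists m, p = mono m)).

Definition mingen (I : sset) (m : 'X_{1..n}) :=
  I (mono m) /\ forall m', I (mono m') -> mdiv m' m -> m' = m.

Definition supp2 (m : 'X_{1..n}) (i j : 'I_n) :=
  [/\ (i < j)%N, (0 < m i)%N, (0 < m j)%N & forall k, k != i -> k != j -> m k = 0%N].

Definition support2_ideal (I : sset) :=
  monomial_ideal I /\ forall m, mingen I m -> exists i j, supp2 m i j.

Definition edgeG (I : sset) (i j : 'I_n) :=
  exists m, mingen I m /\ (supp2 m i j \/ supp2 m j i).

Definition bipartite (E : 'I_n -> 'I_n -> Prop) :=
  exists c : 'I_n -> bool, forall i j, E i j -> c i != c j.

Definition squarefree_monomial_ideal (J : sset) :=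
  monomial_ideal J /\ forall m, mingen J m -> forall i, (m i <= 1)%N.

Definition rad (I : sset) : sset := fun f => exists k : nat, I (f ^+ k).

Definition weight (d : 'I_n -> nat) (m : 'X_{1..n}) : 'X_{1..n} :=
  [multinom (d i * m i)%N | i < n].
Definition weighted (J : sset) (d : 'I_n -> nat) : sset :=
  genI (fun p => exists m, mingen J m /\ p = mono (weight d m)).
Definition std_weighting (d : 'I_n -> nat) := forall i, (0 < d i)%N.

Definition has_std_lin_weighting (I : sset) :=
  exists d, std_weighting d /\ seqv I (weighted (rad I) d).

Definition powI (I : sset) (s : nat) : sset :=
  genI (fun p => exists l : seq S, [/\ size l = s, (forall f, f \in l -> I f) &
                                       p = \prod_(f <- l) f]).

Definition prime_ideal (P : sset) :=
  [/\ is_ideal P, ~ P 1 & forall f g, P (f * g) -> P f \/ P g].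

Definition min_prime (I : sset) (P : sset) :=
  [/\ prime_ideal P, ssub I P &
      forall Q, prime_ideal Q -> ssub I Q -> ssub Q P -> ssub P Q].

Definition ass_prime (I : sset) (P : sset) :=
  prime_ideal P /\ exists f : S, seqv P (fun g => I (f * g)).

Definition no_embedded_primes (I : sset) :=
  forall P, ass_prime I P -> min_prime I P.

(* I S_P \cap S  =  { f | g f in I for some g not in P } *)
Definition contr_loc (I : sset) (P : sset) : sset :=
  fun f => exists g, ~ P g /\ I (g * f).

Definition symb_pow (I : sset) (s : nat) : sset :=
  fun f => forall P, min_prime I P -> contr_loc (powI I s) P f.

Definition Simis (I : sset) :=
  forall s, (1 <= s)%N -> seqv (symb_pow I s) (powI I s).

Definition irreducible_ideal (Q : sset) :=
  [/\ is_ideal Q, ~ Q 1 &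
      forall J1 J2, is_ideal J1 -> is_ideal J2 -> seqv Q (scap J1 J2) ->
        seqv Q J1 \/ seqv Q J2].

Definition bigcapI (Qs : seq sset) : sset :=
  fun f => forall k, (k < size Qs)%N -> nth (fun _ => True) Qs k f.

Definition irr_decomposition (I : sset) (Qs : seq sset) :=
  [/\ forall k, (k < size Qs)%N ->
        irreducible_ideal (nth (fun _ => True) Qs k) /\ monomial_ideal (nth (fun _ => True) Qs k),
      seqv I (bigcapI Qs) &
      forall k, (k < size Qs)%N ->
        ~ ssub (bigcapI (take k Qs ++ drop k.+1 Qs)) (nth (fun _ => True) Qs k)].

Definition minimal_irr_decomposition (I : sset) :=
  exists Qs, irr_decomposition I Qs /\
    forall k l, (k < size Qs)%N -> (l < size Qs)%N -> k <> l ->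
      ~ seqv (rad (nth (fun _ => True) Qs k)) (rad (nth (fun _ => True) Qs l)).

End MonomialIdeals.

(* Main.v *)
(** Everything is read off from exponent vectors. Each component [Q] of the
    decomposition is generated by pure powers, and a minimal prime of [I] contains
    exactly one of them; so a monomial lies in [I^(s)] as soon as it is divisible by
    a product of [s] monomials of [Q], for every [Q].

    Suppose [I] is Simis. If [g], [g'] are two generators on one edge [ij], then
    [g g' / (x_i x_j)] lies in [I^(2) = I^2], which produces a pair of smaller degree;
    so each edge carries one generator. If the generators [g], [g'] on [ab], [ac] have
    different exponents at [a], then [g g' / x_a] lies in [I^2], which is only possible
    if the generator on [bc] squared divides it; running around the triangle gives a
    contradiction. Hence [x_i] occurs with a single exponent [d_i], and an odd closed
    walk of length [2r + 1] would give [prod x_v^(d_v)] in the symbolic power of order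
    [r + 1] but not in the ordinary one, whose monomials have weighted degree at least
    [2r + 2].

    Conversely, every minimal vertex cover [C] gives the minimal prime [(x_i, i in C)],
    so a monomial [m] of an element of [I^(s)] satisfies
    [sum_(i in C) floor (m_i / d_i) >= s] for all covers [C]; Koenig's theorem with
    vertex capacities [floor (m_i / d_i)] then exhibits [s] generators whose product
    divides [m]. *)
From Stdlib Require Import Classical.
From mathcomp Require Import all_boot all_algebra.
From mathcomp Require Import mpoly zify.
Require Import Defs.
Set Implicit Arguments. Unset Strict Implicit. Unset Printing Implicit Defensive.
Import GRing.Theory.
Local Open Scope ring_scope.

(** * Monomial ideals as up-closed sets of exponent vectors *)

Section MonomialSpans.
Variables (K : fieldType) (n : nat).
Local Notation sset := (sset K n).
Implicit Types (A B : 'X_{1..n} -> Prop) (I J P : sset) (m u : 'X_{1..n}).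
Implicit Types (f g : {mpoly K[n]}).

Definition up_closed A := forall m m', A m -> mdiv m m' -> A m'.
(** This is an ideal once [A] is up-closed, and by [monomial_idealP] every monomial ideal has this
    form. *)
Definition mspan A : sset := fun f => forall m, m \in msupp f -> A m.
Definition monomials I : 'X_{1..n} -> Prop := fun m => I (mono K m).
Definition above B : 'X_{1..n} -> Prop := fun m => exists m0, B m0 /\ mdiv m0 m.
(** If [A] holds the exponents of an ideal spanned by monomials, these are the exponents of its
    [s]-th power; see [powI_monoE]. *)
Definition mprod_above A s : 'X_{1..n} -> Prop := fun m =>
  exists l : seq 'X_{1..n},
    [/\ size l = s, forall u, u \in l -> A u & mdiv (\sum_(u <- l) u)%MM m].

Lemma mdivP m m' : reflect (mdiv m m') (m <= m')%MM.
Proof. exact: mnm_lepP. Qed.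

Lemma mdiv_refl m : mdiv m m. Proof. by move=> i. Qed.

Lemma mdiv_trans m u m' : mdiv m u -> mdiv u m' -> mdiv m m'.
Proof. by move=> h1 h2 i; apply: leq_trans (h1 i) (h2 i). Qed.

Lemma mdivDl m u : mdiv m (u + m)%MM.
Proof. by move=> i; rewrite mnmDE leq_addl. Qed.

Lemma mdivD m u m' u' : mdiv m m' -> mdiv u u' -> mdiv (m + u)%MM (m' + u')%MM.
Proof. by move=> h1 h2 i; rewrite !mnmDE leq_add. Qed.

Lemma mdiv_subK m m' : mdiv m m' -> m' = (m' - m + m)%MM.
Proof. by move=> /mdivP h; rewrite submK. Qed.

Lemma mspanX A m : mspan A (mono K m) <-> A m.
Proof.
rewrite /mspan /mono msuppX; split=> [h|Am u]; first by apply: h; rewrite inE.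
by rewrite inE => /eqP ->.
Qed.

Lemma msupp_mulP f g m : m \in msupp (f * g) ->
  exists m1 m2, [/\ m1 \in msupp f, m2 \in msupp g & m = (m1 + m2)%MM].
Proof. by move=> /msuppM_le /allpairsP [[m1 m2] /= [h1 h2 ->]]; exists m1, m2. Qed.

Lemma mspan_ideal A : up_closed A -> is_ideal (mspan A).
Proof.
move=> upA; split=> [m|f g hf hg m|h f hf m].
- by rewrite msupp0.
- by move=> /msuppD_le; rewrite mem_cat => /orP [/hf|/hg].
- move=> /msupp_mulP [m1 [m2 [_ /hf Am2 ->]]].
  by apply: upA Am2 (mdivDl _ _).
Qed.

Lemma ideal_sum I (T : eqType) (r : seq T) (F : T -> {mpoly K[n]}) :
  is_ideal I -> (forall x, x \in r -> I (F x)) -> I (\sum_(x <- r) F x).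
Proof.
case=> I0 ID _; elim: r => [|x r IHr] hF; first by rewrite big_nil.
rewrite big_cons; apply: ID; first by apply: hF; rewrite inE eqxx.
by apply: IHr => y yr; apply: hF; rewrite inE yr orbT.
Qed.

Lemma idealN I f : is_ideal I -> I f -> I (- f).
Proof. by case=> _ _ IM If; rewrite -mulN1r; apply: IM. Qed.

Lemma idealMr I f g : is_ideal I -> I f -> I (f * g).
Proof. by case=> _ _ IM If; rewrite mulrC; apply: IM. Qed.

Lemma genI_mem (X : sset) f : X f -> genI X f.
Proof.
move=> Xf; exists [:: (1, f)]; split=> [p|]; first by rewrite inE => /eqP ->.
by rewrite big_seq1 mul1r.
Qed.

Lemma genI_ideal (X : sset) : is_ideal (genI X).
Proof.
split.
- by exists [::]; split=> //; rewrite big_nil.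
- move=> f g [s [hs ->]] [t [ht ->]]; exists (s ++ t); rewrite big_cat.
  by split=> // p; rewrite mem_cat => /orP [/hs|/ht].
- move=> h f [s [hs ->]]; exists [seq (h * p.1, p.2) | p <- s]; split.
    by move=> p /mapP [q /hs Xq ->].
  by rewrite big_map mulr_sumr; apply: eq_bigr => p _; rewrite mulrA.
Qed.

Lemma genI_min (X : sset) I :
  is_ideal I -> (forall f, X f -> I f) -> ssub (genI X) I.
Proof.
move=> idI XI f [s [hs ->]]; apply: ideal_sum => // p /hs /XI.
by case: idI => _ _; apply.
Qed.

Lemma ideal_up_closed I : is_ideal I -> up_closed (monomials I).
Proof.
case=> _ _ IM m m' Im /mdiv_subK ->.
by rewrite /monomials /mono mpolyXD; apply: IM.
Qed.

Lemma mspan_monomials_sub I : is_ideal I -> ssub (mspan (monomials I)) I.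
Proof.
move=> idI f hf; rewrite [f]mpolyE; apply: ideal_sum => // m /hf Im.
by rewrite -mul_mpolyC; case: idI => _ _; apply.
Qed.

Lemma monomial_idealP I :
  monomial_ideal I -> is_ideal I /\ seqv I (mspan (monomials I)).
Proof.
move=> mI; have idI : is_ideal I.
  have [h0 hD hM] := genI_ideal (fun p => I p /\ exists m, p = mono K m).
  split; first exact/mI.
    by move=> f g /mI hf /mI hg; apply/mI; apply: hD.
  by move=> h f /mI hf; apply/mI; apply: hM.
split=> // f; split; last exact: mspan_monomials_sub.
move=> /mI; apply: genI_min; first exact: mspan_ideal (ideal_up_closed idI).
by move=> p [Ip [m ep]]; rewrite ep; apply/mspanX; rewrite /monomials -ep.
Qed.

Lemma mspan_monomial I A : up_closed A -> seqv I (mspan A) -> monomial_ideal I.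
Proof.
move=> upA IA f; split; last first.
  move=> hf; apply/IA; move: hf; apply: (genI_min (mspan_ideal upA)).
  by move=> p [/IA].
move=> /IA hf; apply: mspan_monomials_sub; first exact: genI_ideal.
move=> m /hf Am; apply: genI_mem; split; last by exists m.
by apply/IA/mspanX.
Qed.

Lemma up_mprod_above A s : up_closed (mprod_above A s).
Proof.
move=> m m' [l [sl hl lm]] mm'; exists l; split=> //; exact: mdiv_trans mm'.
Qed.

Lemma mprod_above_cons A s m u :
  A m -> mprod_above A s u -> mprod_above A s.+1 (m + u)%MM.
Proof.
move=> Am [l [sl hl lu]]; exists (m :: l); split=> /=; first by rewrite sl.
  by move=> v; rewrite inE => /orP [/eqP ->|/hl].
by rewrite big_cons; apply: mdivD.
Qed.

Lemma mprod_above0 A m : mprod_above A 0 m.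
Proof. by exists [::]; split=> // i; rewrite big_nil mnm0E. Qed.

Lemma mprod_above_leq A s t m :
  (s <= t)%N -> mprod_above A t m -> mprod_above A s m.
Proof.
move=> st [l [sl hl lm]]; exists (take s l); split.
- by rewrite size_take_min sl; apply/minn_idPl.
- by move=> u /mem_take /hl.
apply: mdiv_trans lm; rewrite -{2}(cat_take_drop s l) big_cat /= => i.
by rewrite mnmDE leq_addr.
Qed.

(** A monomial of a product is a sum of exponents, one from each factor. Conversely, a monomial
    above a sum of [s] elements of [A] is a multiple of a product of [s] monomials of [I]. *)
Lemma powI_monoE I A s :
  up_closed A -> seqv I (mspan A) -> seqv (powI I s) (mspan (mprod_above A s)).
Proof.
move=> upA IA f; split.
  apply: (genI_min (mspan_ideal (@up_mprod_above A s))) => _ [l [<- hl ->]].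
  elim: l hl => [|g l IHl] hl; first by move=> m _; apply: mprod_above0.
  rewrite big_cons => m /msupp_mulP [m1 [m2 [h1 h2 ->]]].
  apply: mprod_above_cons; first by apply: (proj1 (IA g)) h1; apply: hl; rewrite inE eqxx.
  by apply: IHl h2 => h hh; apply: hl; rewrite inE hh orbT.
move=> hf; apply: mspan_monomials_sub; first exact: genI_ideal.
move=> m /hf [l [sl hl /mdiv_subK ->]]; rewrite /monomials /mono mpolyXD.
case: (genI_ideal (fun p => exists l : seq {mpoly K[n]},
   [/\ size l = s, (forall f, f \in l -> I f) & p = \prod_(f <- l) f])) => _ _; apply.
apply: genI_mem; exists [seq mono K u | u <- l]; rewrite size_map; split=> //.
  by move=> g /mapP [u /hl Au ->]; apply/IA/mspanX.
by rewrite big_map mpolyX_prod.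
Qed.

(* Dropping the terms of [f] that lie in the span leaves a polynomial whose
   leading monomial is outside; as [mlead] is multiplicative, this takes the
   place of graded arguments below. *)
Lemma mspan_rest A f : ~ mspan A f ->
  exists a b, [/\ f = a + b, mspan A a, b != 0 &
                  forall m, m \in msupp b -> m \in msupp f /\ ~ A m].
Proof.
elim: {f}(size (msupp f)) {-2}f (erefl (size (msupp f))) => [|k IHk] f sf nAf.
  by case: nAf => m; rewrite (size0nil sf).
have [h|h] := classic (exists m, m \in msupp f /\ A m); last first.
  exists 0, f; rewrite add0r; split=> //.
  - by move=> m; rewrite msupp0.
  - by apply/eqP => f0; rewrite f0 msupp0 in sf.
  - by move=> m mf; split=> // Am; apply: h; exists m.
have [m [mf Am]] := h; set g := f - f@_m *: 'X_[m].
have pg : perm_eq (msupp g) (rem m (msupp f)) by apply: msupp_rem.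
have gf u : u \in msupp g -> u \in msupp f.
  by rewrite (perm_mem pg); apply: mem_rem.
have sX : mspan A (f@_m *: 'X_[m]).
  by move=> u /msuppZ_le; rewrite msuppX inE => /eqP ->.
have nAg : ~ mspan A g.
  move=> Ag; apply: nAf => u uf; have [->//|um] := eqVneq u m.
  apply: Ag; rewrite (perm_mem pg) mem_rem_uniq ?msupp_uniq // inE um.
  exact: uf.
have sg : size (msupp g) = k.
  by rewrite (perm_size pg) size_rem // sf.
have [a [b [gab Aa b0 hb]]] := IHk g sg nAg.
exists (f@_m *: 'X_[m] + a), b; split=> //.
- by rewrite -addrA -gab /g addrC subrK.
- by move=> u /msuppD_le; rewrite mem_cat => /orP [/sX|/Aa].
- by move=> u /hb [/gf].
Qed.

End MonomialSpans.

(** * Monomial primes, irreducible components and symbolic powers *)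

Section PrimesAndRadicals.
Variables (K : fieldType) (n : nat).
Local Notation sset := (sset K n).
Implicit Types (A B : 'X_{1..n} -> Prop) (I J P Q : sset) (m u : 'X_{1..n}).
Implicit Types (f g : {mpoly K[n]}) (C : 'I_n -> Prop).

(** These are the exponents of the prime generated by the variables [x_i] with [i] in [C]. *)
Definition meets C m := exists i, C i /\ (0 < m i)%N.

Lemma up_meets C : up_closed (meets C).
Proof. by move=> m m' [i [Ci mi]] mm'; exists i; split=> //; apply: leq_trans (mm' i). Qed.

Lemma ideal_restM I f g a b a' b' : is_ideal I ->
  f = a + b -> g = a' + b' -> I a -> I a' -> I (f * g) -> I (b * b').
Proof.
move=> idI -> -> Ia Ia' Ifg; have [_ ID IM] := idI.
have -> : b * b' = (a + b) * (a' + b') + (- (a * (a' + b')) + - (b * a')).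
  by rewrite mulrDl [b * (_ + _)]mulrDr addrACA subrr add0r addrC addrA addNr add0r.
apply: (ID _ _ Ifg); apply: ID; apply: (idealN idI); first exact: idealMr.
exact: IM.
Qed.

(** If neither factor lies in the ideal, drop the terms that do. The leading monomial of the product
    of the two rests is the sum of two exponents that avoid [C], so it avoids [C] as well. *)
Lemma meets_prime C : prime_ideal (mspan (meets C) : sset).
Proof.
have idP := @mspan_ideal K n _ (@up_meets C); split=> //.
  by move=> /(_ 0%MM); rewrite msupp1 inE eqxx => /(_ isT) [i []]; rewrite mnm0E.
move=> f g Pfg; apply: NNPP => /not_or_and [nPf nPg].
have [a [b [fab Pa b0 hb]]] := mspan_rest nPf.
have [a' [b' [gab Pa' b0' hb']]] := mspan_rest nPg.
have Pbb := ideal_restM idP fab gab Pa Pa' Pfg.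
have /Pbb : mlead (b * b') \in msupp (b * b') by rewrite mlead_supp // mulf_neq0.
rewrite mleadM // => -[i [Ci]]; rewrite mnmDE addn_gt0 => /orP [h|h].
  by case: (hb _ (mlead_supp b0)) => _; apply; exists i.
by case: (hb' _ (mlead_supp b0')) => _; apply; exists i.
Qed.

Lemma prime_exp P f k : prime_ideal P -> P (f ^+ k) -> P f.
Proof.
case=> _ P1 PM; elim: k => [|k IHk]; first by rewrite expr0 => /P1.
by rewrite exprS => /PM [].
Qed.

Lemma rad_ideal I : is_ideal I -> is_ideal (rad I).
Proof.
move=> idI; have [I0 ID IM] := idI; split.
- by exists 1%N; rewrite expr1.
- move=> f g [k Ik] [l Il]; exists (k + l)%N; rewrite exprDn.
  apply: ideal_sum => // i _; rewrite -mulr_natl; apply: (IM).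
  have [ile|lti] := leqP l i.
    by apply: (IM); rewrite -(subnK ile) exprD; apply: (IM).
  apply: idealMr => //; have -> : (k + l - i = (l - i) + k)%N by lia.
  by rewrite exprD; apply: (IM).
- by move=> h f [k Ik]; exists k; rewrite exprMn; apply: (IM).
Qed.

Lemma mdivU i m : mdiv U_(i)%MM m <-> (0 < m i)%N.
Proof.
split=> [/(_ i)|mi j]; first by rewrite mnm1E eqxx.
by rewrite mnm1E; case: eqP => // <-.
Qed.

Lemma mspan_meets_rad I C : is_ideal I ->
  (forall i, C i -> rad I (mono K U_(i)%MM)) -> ssub (mspan (meets C)) (rad I).
Proof.
move=> idI hC f hf; apply: mspan_monomials_sub; first exact: rad_ideal.
move=> m /hf [i [Ci mi]].
apply: (ideal_up_closed (rad_ideal idI)) (hC i Ci) _; exact/mdivU.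
Qed.

(** As [x^u] and [x^m] are coprime, a monomial divisible by both is divisible by their product.
    Hence [Q] is the intersection of [Q + (x^u)] and [Q + (x^m)], and irreducibility applies. *)
Lemma irreducible_coprime Q u m :
  irreducible_ideal Q -> monomial_ideal Q -> (forall i, u i = 0%N \/ m i = 0%N) ->
  Q (mono K (u + m)%MM) -> Q (mono K u) \/ Q (mono K m).
Proof.
move=> [idQ Q1 irrQ] mQ um Qum; have [_ QE] := monomial_idealP mQ.
pose J w := mspan (fun v => monomials Q v \/ mdiv w v) : sset.
have upJ w : up_closed (fun v => monomials Q v \/ mdiv w v).
  move=> v v' [Qv|wv] vv'; first by left; apply: ideal_up_closed Qv vv'.
  by right; apply: mdiv_trans vv'.
have Jw w : J w (mono K w) by apply/mspanX; right; apply: mdiv_refl.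
have [||f|/(_ (mono K u)) h|/(_ (mono K m)) h] := irrQ (J u) (J m).
- exact: mspan_ideal.
- exact: mspan_ideal.
- split=> [/QE Qf|[hu hm]]; first by split=> v /Qf; left.
  apply/QE => v vf; case: (hu v vf) => // uv; case: (hm v vf) => // mv.
  apply: (ideal_up_closed idQ) Qum _ => i; rewrite mnmDE.
  by case: (um i) => ->; rewrite ?add0n ?addn0.
- by left; apply/h.
- by right; apply/h.
Qed.

(** The monomial is a product of coprime pure powers, which [irreducible_coprime] splits off one
    variable at a time; the process cannot end at 1, which is not in [Q]. *)
Lemma irreducible_pure_power Q m :
  irreducible_ideal Q -> monomial_ideal Q -> Q (mono K m) ->
  exists i, (0 < m i)%N /\ Q (mono K (U_(i) *+ m i)%MM).
Proof.
move=> irrQ mQ; have nQ0 : ~ Q (mono K 0%MM).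
  by rewrite /mono mpolyX0; case: irrQ.
suff H : forall r : seq 'I_n, uniq r -> Q (mono K (\sum_(i <- r) U_(i) *+ m i)%MM) ->
    exists i, Q (mono K (U_(i) *+ m i)%MM).
  rewrite [in X in X -> _](multinomUE_id m) => /(H _ (index_enum_uniq _)) [i Qi].
  exists i; split=> //; rewrite lt0n; apply/eqP => mi; apply: nQ0.
  by rewrite mi mulm0n in Qi.
elim=> [|i r IHr] /=; first by rewrite big_nil => _ /nQ0.
move=> /andP [ir ur]; rewrite big_cons => /(irreducible_coprime irrQ mQ).
case=> [j||]; last exact: IHr.
  have [<-|ij] := eqVneq i j; [right|left]; last by rewrite mulmnE mnm1E (negPf ij).
  rewrite mnm_sumE big_seq big1 // => k kr; rewrite mulmnE mnm1E.
  by case: eqP kr ir => // <- ->.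
by move=> Qi; exists i.
Qed.

(** Let [C] be the set of variables with a power in [Q]. Then [I <= Q <= (C) <= P], so minimality of
    [P] gives [P = (C)], and [(C)] lies in the radical of [Q]. *)
Lemma rad_eq_min_prime I Q P :
  irreducible_ideal Q -> monomial_ideal Q -> ssub I Q -> min_prime I P ->
  (forall m, Q (mono K m) -> P (mono K m)) -> seqv (rad Q) P.
Proof.
move=> irrQ mQ IQ [prP IP minP] QP; have [idQ QE] := monomial_idealP mQ.
have [idP _ _] := prP.
pose C i := exists k, Q (mono K (U_(i) *+ k)%MM).
have QC : ssub Q (mspan (meets C)).
  move=> f /QE Qf m /Qf /(irreducible_pure_power irrQ mQ) [i [mi Qi]].
  by exists i; split=> //; exists (m i).
have CP : ssub (mspan (meets C)) P.
  move=> f hf; apply: mspan_monomials_sub => // m /hf [i [[k Qk] mi]].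
  apply: (ideal_up_closed idP) (proj2 (mdivU i m) mi).
  by apply: (prime_exp (k := k)) => //; rewrite /mono mpolyXn; apply: QP.
have PC := minP _ (meets_prime C) (fun f If => QC f (IQ f If)) CP.
move=> f; split=> [[k /QC /CP]|/PC]; first exact: prime_exp.
apply: mspan_meets_rad => // i [k Qk]; exists k.
by rewrite /mono mpolyXn.
Qed.

(** Localizing at [P] makes every component not contained in [P] trivial, and distinct radicals
    leave only one other component. *)
Lemma symb_pow_mono I (Qs : seq sset) s m (Q := nth (fun _ => True) Qs) :
  irr_decomposition I Qs ->
  (forall k l, (k < size Qs)%N -> (l < size Qs)%N -> k <> l ->
    ~ seqv (rad (Q k)) (rad (Q l))) ->
  (forall k, (k < size Qs)%N -> mprod_above (monomials (Q k)) s m) ->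
  symb_pow I s (mono K m).
Proof.
move=> [irrQ IQ _] radQ hm P minP; have [prP IP _] := minP.
have [idP P1 PM] := prP.
pose L k := exists u, Q k (mono K u) /\ ~ P (mono K u).
(* Multiplying one monomial outside [P] from each component that has one gives [U], still outside
   [P]. *)
have [U [nPU hU]] : exists U, ~ P (mono K U) /\
    forall k, (k < size Qs)%N -> L k -> Q k (mono K U).
  suff H N : exists U, ~ P (mono K U) /\
    forall k, (k < N)%N -> (k < size Qs)%N -> L k -> Q k (mono K U).
    by have [U [nPU hU]] := H (size Qs); exists U; split=> // k kl; apply: hU.
  elim: N => [|N [U [nPU hU]]].
    by exists 0%MM; split=> //; rewrite /mono mpolyX0.
  have [[u [Qu nPu]]|nL] := classic (L N); last first.
    exists U; split=> // k; rewrite ltnS leq_eqVlt => /orP [/eqP -> _ /nL //|].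
    exact: hU.
  exists (u + U)%MM; split; first by rewrite /mono mpolyXD => /PM [].
  move=> k; rewrite ltnS => kN ks Lk.
  have idQ := proj1 (monomial_idealP (proj2 (irrQ k ks))).
  rewrite /mono mpolyXD; move: kN; rewrite leq_eqVlt => /orP [/eqP kN|kN].
    by apply: idealMr => //; rewrite kN.
  by case: (idQ) => _ _; apply; apply: hU.
have IE u : I (mono K u) <-> forall k, (k < size Qs)%N -> Q k (mono K u).
  by split=> [/IQ|h]; last apply/IQ.
have [k [ks nLk]] : exists k, (k < size Qs)%N /\ ~ L k.
  apply: NNPP => h; apply: nPU; apply/IP/IE => k ks; apply: hU => //.
  by apply: NNPP => nL; apply: h; exists k.
have QP l : ~ L l -> forall u, Q l (mono K u) -> P (mono K u).
  by move=> nL u Qu; apply: NNPP => nPu; apply: nL; exists u.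
have subQ l : (l < size Qs)%N -> ssub I (Q l) by move=> ls f /IQ; apply.
(* A second component inside [P] would also have radical [P]. *)
have Lk l : (l < size Qs)%N -> l <> k -> L l.
  move=> ls lk; apply: NNPP => nLl; apply: (radQ l k ls ks lk) => f.
  have [[irl ml] [irk mk]] := (irrQ l ls, irrQ k ks).
  rewrite (rad_eq_min_prime irl ml (subQ l ls) minP (QP l nLl) f).
  by rewrite (rad_eq_min_prime irk mk (subQ k ks) minP (QP k nLk) f).
have [l [sl hl lm]] := hm k ks.
(* The denominator [U^s] gives one copy of [U] to each of the [s] factors [u] from [Q k]; then
   [u + U] lies in every component, hence in [I]. *)
exists (mono K (U *+ s)%MM); split.
  by rewrite /mono -mpolyXn => /(prime_exp prP).
rewrite /mono -mpolyXD.
have hp : powI I s (\prod_(u <- l) mono K (u + U)%MM).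
  apply: genI_mem; exists [seq mono K (u + U)%MM | u <- l].
  rewrite size_map big_map; split=> // f /mapP [u ul ->]; apply/IE => k' k's.
  have idQ := proj1 (monomial_idealP (proj2 (irrQ k' k's))).
  have [kk|kk] := eqVneq k' k.
    rewrite /mono mpolyXD; apply: idealMr => //.
    by rewrite kk; apply: hl.
  rewrite /mono mpolyXD; case: (idQ) => _ _; apply; apply: hU => //.
  by apply: Lk => //; apply/eqP.
have -> : (U *+ s + m = (m - \sum_(u <- l) u) + \sum_(u <- l) (u + U))%MM.
  rewrite big_split /= addmA -(mdiv_subK lm) addmC; congr (_ + _)%MM.
  by rewrite -sl; elim: (l) => [|a l' IH]; rewrite ?big_nil ?mulm0n // big_cons /= mulmS IH.
rewrite mpolyXD -(big_map (fun u => u + U)%MM xpredT (fun u => u)).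
rewrite -mpolyX_prod big_map.
by case: (genI_ideal (fun p : {mpoly K[n]} => exists l0 : seq {mpoly K[n]},
   [/\ size l0 = s, (forall f, f \in l0 -> I f) & p = \prod_(f <- l0) f])) => _ _; apply.
Qed.

End PrimesAndRadicals.

(** * Koenig's theorem with capacities, and odd closed walks *)

Section BipartiteGraphs.
Variables (V : finType) (e : rel V).
Hypothesis e_sym : ssrbool.symmetric e.
Local Open Scope nat_scope.

Definition vcover (C : {set V}) := [forall u, forall v, e u v ==> (u \in C) || (v \in C)].

Lemma vcoverP (C : {set V}) : reflect (forall u v, e u v -> (u \in C) || (v \in C)) (vcover C).
Proof.
apply: (iffP forallP) => [h u v euv|h u]; first by move/forallP/(_ v)/implyP: (h u); apply.
by apply/forallP => v; apply/implyP/h.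
Qed.

Lemma sum_setE (c : V -> nat) (C : {set V}) :
  \sum_(v in C) c v = \sum_v (v \in C) * c v.
Proof. by rewrite big_mkcond; apply: eq_bigr => v _; case: (v \in C); rewrite ?mul1n. Qed.

(* A tight cover through [a] with the largest part on the other side misses a
   neighbour [b] of [a] of positive capacity; since tight covers form a lattice,
   no tight cover contains both ends of [ab], which can be put in the matching. *)
Lemma koenig_capacities (col : V -> bool) (s : nat) (c : V -> nat) :
  (forall u v, e u v -> col u != col v) ->
  (forall C : {set V}, vcover C -> s <= \sum_(v in C) c v) ->
  exists l : seq (V * V), [/\ size l = s, forall p, p \in l -> e p.1 p.2 &
    forall v, \sum_(p <- l) ((p.1 == v) + (p.2 == v)) <= c v].
Proof.
move=> hcol; have [N] := ubnP (\sum_v c v); elim: N s c => // N IHN [|s] c ltN hs.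
  by exists [::]; split=> // v; rewrite big_nil.
(* One colour class is a cover, so it cannot have total capacity zero. *)
have [a cola ca] : exists2 a, col a & 0 < c a.
  have covA : vcover [set v | col v].
    by apply/vcoverP => u v /hcol; rewrite !inE; case: (col u); case: (col v).
  apply/exists_inP; apply: contraT; rewrite negb_exists_in => /forall_inP h.
  move: (hs _ covA); rewrite big1 // => v; rewrite inE => /h.
  by rewrite -eqn0Ngt => /eqP.
have sum_dec (c' : V -> nat) x (C : {set V}) : 0 < c' x ->
    \sum_(v in C) c' v = \sum_(v in C) (c' v - (v == x)) + (x \in C).
  move=> cx; have [xC|xC] := boolP (x \in C).
    rewrite !(big_setD1 x xC) /= eqxx -addnA [_ + true]addnC addnA subnK //.
    by congr (_ + _); apply: eq_bigr => v; rewrite !inE => /andP [/negPf ->]; rewrite subn0.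
  rewrite addn0; apply: eq_bigr => v vC; case: eqP => [vx|]; last by rewrite subn0.
  by rewrite -vx vC in xC.
have tot (c' : V -> nat) : \sum_v c' v = \sum_(v in [set: V]) c' v.
  by apply: eq_bigl => v; rewrite inE.
have sub_leq (c' : V -> nat) (l : seq (V * V)) : (forall v, c' v <= c v) ->
    (forall v, \sum_(p <- l) ((p.1 == v) + (p.2 == v)) <= c' v) ->
    forall v, \sum_(p <- l) ((p.1 == v) + (p.2 == v)) <= c v.
  by move=> cc h v; apply: leq_trans (h v) (cc v).
(* Lower the capacity of [a] by one. If every cover keeps capacity at least [s.+1], the induction
   hypothesis applies; otherwise some cover through [a] is tight. *)
pose c1 v := c v - (v == a).
have [/forallP h1|] := boolP [forall C : {set V}, vcover C ==> (s < \sum_(v in C) c1 v)].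
  have [||l [sl el ml]] := IHN s.+1 c1; last first.
  - by exists l; split=> //; apply: sub_leq ml => v; apply: leq_subr.
  - by move=> C; apply/implyP.
  by move: ltN; rewrite tot (sum_dec c a) // inE -tot addn1 ltnS.
rewrite negb_forall => /existsP [T0]; rewrite negb_imply -leqNgt => /andP [covT0 leT0].
pose tight T := [&& vcover T, a \in T & \sum_(v in T) c v == s.+1].
have tT0 : tight T0.
  rewrite /tight covT0 /=; move: (hs _ covT0) leT0; rewrite (sum_dec c a T0 ca) /c1.
  by case: (a \in T0) => /=; clear; lia.
have [T /and3P [covT aT /eqP sT] maxT] :=
  @arg_maxnP _ T0 tight (fun T => #|T :\: [set v | col v]|) tT0.
(* Otherwise all neighbours of [a] lie in [T] or have capacity zero, and trading [a] for the
   vertices of capacity zero gives a cover of capacity below [s.+1]. *)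
have [b /and3P [eab cb bT]] : exists b, [&& e a b, 0 < c b & b \notin T].
  apply/existsP; apply: contraT; rewrite negb_exists => /forallP h.
  have nbr v : e a v -> v \in (T :\ a) :|: [set v | c v == 0].
    move=> eav; rewrite !inE; have := h v; rewrite eav /= negb_and negbK -eqn0Ngt.
    have -> : v != a by apply/eqP => va; have := hcol _ _ eav; rewrite va eqxx.
    by rewrite orbC.
  have covD : vcover ((T :\ a) :|: [set v | c v == 0]).
    apply/vcoverP => u v euv; have [ua|ua] := eqVneq u a.
      by apply/orP; right; apply: nbr; rewrite -ua.
    have [va|va] := eqVneq v a.
      by apply/orP; left; apply: nbr; rewrite -va e_sym.
    by move/vcoverP: covT => /(_ u v euv); rewrite !inE ua va => /orP [->|->]; rewrite ?orbT.
  have := hs _ covD; rewrite leqNgt => /negP []; rewrite -sT (big_setD1 a aT) /=.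
  suff -> : \sum_(v in (T :\ a) :|: [set v | c v == 0]) c v = \sum_(v in T :\ a) c v.
    by move: ca; clear; lia.
  rewrite !sum_setE; apply: eq_bigr => v _; rewrite [in LHS]in_setU [v \in [set _ | _]]inE.
  by case: eqP => [->|_]; rewrite ?muln0 // orbF.
have nba : b != a by apply/eqP => ba; have := hcol _ _ eab; rewrite ba eqxx.
have colb : ~~ col b by have := hcol _ _ eab; rewrite cola; case: (col b).
pose c2 v := c v - (v == a) - (v == b).
have sum2 (C : {set V}) : \sum_(v in C) c v = \sum_(v in C) c2 v + (a \in C) + (b \in C).
  rewrite (sum_dec c a C ca) (sum_dec (fun v => c v - (v == a)) b) ?(negPf nba) ?subn0 //.
  by rewrite addnAC.
have [||l [sl el ml]] := IHN s c2; last first.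
- exists ((a, b) :: l); split=> /=; first by rewrite sl.
    by move=> p; rewrite inE => /orP [/eqP -> //|/el].
  move=> v; rewrite big_cons /=; have := ml v; rewrite /c2 (eq_sym v a) (eq_sym v b).
  have : (a == v) + (b == v) <= c v.
    have [<-|_] := eqVneq a v; first by rewrite (negPf nba).
    by have [<-|//] := eqVneq b v.
  by move: (\sum_(p <- l) _) => S; move: (nat_of_bool _) (nat_of_bool _); clear; lia.
- move=> C covC; have := hs _ covC; have := sum2 C.
  have [aC|aC] := boolP (a \in C); have [bC|bC] := boolP (b \in C) => /=;
    rewrite ?addn0 ?addn1; try by move=> ->.
  - move=> eC hC; suff : \sum_(v in C) c v != s.+1 by move: eC hC; clear; lia.
    apply/eqP => sC.
    (* [D] and [D'] are the meet and join of [T] and [C], ordered by inclusion on one side and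
       reverse inclusion on the other. Their capacities add up to twice [s.+1], so both are tight;
       but [D] contains [b] and contradicts the choice of [T]. *)
    pose D := [set v | if col v then (v \in T) && (v \in C) else (v \in T) || (v \in C)].
    pose D' := [set v | if col v then (v \in T) || (v \in C) else (v \in T) && (v \in C)].
    have covDD : vcover D && vcover D'.
      apply/andP; split; apply/vcoverP => u v euv; rewrite !inE; move: (hcol _ _ euv);
      move/vcoverP: covT => /(_ u v euv); move/vcoverP: covC => /(_ u v euv);
      by case: (col u); case: (col v); case: (u \in T); case: (v \in T);
         case: (u \in C); case: (v \in C).
    case/andP: covDD => covD covD'.
    have sDD : \sum_(v in D) c v + \sum_(v in D') c v
        = \sum_(v in T) c v + \sum_(v in C) c v.
      rewrite !sum_setE -!big_split /=; apply: eq_bigr => v _; rewrite !inE -!mulnDl.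
      by congr (_ * _); case: (col v); case: (v \in T); case: (v \in C).
    have tD : tight D.
      rewrite /tight covD inE cola aT aC /=.
      by move: (hs _ covD) (hs _ covD') sDD; rewrite sT sC; clear; lia.
    have : #|D :\: [set v | col v]| <= #|T :\: [set v | col v]| := maxT _ tD.
    rewrite leqNgt => /negP []; apply: proper_card; apply/properP; split.
      by apply/subsetP => v; rewrite !inE; case: (col v) => //= ->.
    by exists b; rewrite !inE (negPf colb) ?bC ?orbT // (negPf bT).
  - by move=> -> /ltnW.
- move: ltN; rewrite tot (sum2 [set: V]) !inE -tot /= !addn1 => /ltnW.
  by rewrite !ltnS; apply: leq_trans.
Qed.

(** Each step of the walk has an end in the cover [c], and summing over the steps counts inner
    vertices twice. So a closed walk of length [2r + 1] visits a cover at least [r + 1] times. *)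
Lemma path_vcover (c : pred V) x p :
  (forall u v, e u v -> c u || c v) -> path e x p ->
  size p + c (last x p) <= 2 * count c p + c x.
Proof.
move=> hc; elim: p x => [|y p IHp] x //= /andP [/hc exy /IHp].
by case: (c x) exy; case: (c y) => //=; clear; lia.
Qed.

(** In the double cover on [V * bool], where each step flips the boolean, an odd closed walk at [x]
    is a walk from [(x, true)] to [(x, false)]. *)
Lemma bipartite_or_odd_walk :
  (exists col : V -> bool, forall u v, e u v -> col u != col v) \/
  (exists x p, [/\ path e x p, last x p = x & odd (size p)]).
Proof.
pose e2 (x y : V * bool) := e x.1 y.1 && (x.2 != y.2).
have e2_sym : connect_sym e2.
  by apply: sym_connect_sym => x y; rewrite /e2 e_sym eq_sym.
have [/existsP [x /connectP [q pq lq]]|] := boolP [exists x, connect e2 (x, true) (x, false)].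
  right; exists x, (map fst q).
  have walk y : path e2 y q ->
      path e y.1 (map fst q) /\ odd (size q) = (y.2 != (last y q).2).
    elim: (q) y => [|z r IHr] y /=; first by rewrite eqxx.
    case/andP=> /andP [eyz yz] /IHr [-> ->]; rewrite eyz; split=> //.
    by case: y.2 yz; case: z.2; case: (last z r).2.
  have [-> /=] := walk _ pq; rewrite size_map => ->.
  by rewrite -[x in last x]/((x, true).1) last_map -lq.
rewrite negb_exists => /forallP nodd; left.
(* Without odd closed walks, the chosen root on the sheet [true] reaches exactly one of the two
   copies of each vertex in its component; that copy is the colour. *)
exists (fun v => connect e2 (fingraph.root e v, true) (v, true)) => u v euv.
have eC : connect_sym e := sym_connect_sym e_sym.
have ruv : fingraph.root e u = fingraph.root e v by apply/(fingraph.rootP eC)/connect1.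
have lift x y s : connect e x y -> exists t, connect e2 (x, s) (y, t).
  case/connectP=> p pp ->; elim: p x s pp => [|z p IHp] x s /=; first by exists s.
  case/andP=> exz /(IHp _ (~~ s)) [t h]; exists t; apply: connect_trans h.
  by apply: connect1; rewrite /e2 /= exz; case: (s).
have step t : connect e2 (u, t) (v, ~~ t).
  by apply: connect1; rewrite /e2 /= euv; case: t.
have tf w t : ~~ connect e2 (w, t) (w, ~~ t).
  by case: t => /=; [|rewrite e2_sym]; apply: nodd.
rewrite ruv; set r := fingraph.root e v.
have [t ht] : exists t, connect e2 (r, true) (u, t).
  by apply: lift; rewrite eC /r -ruv connect_root.
have hv := connect_trans ht (step t).
have decide w s s' : connect e2 (r, true) (w, s) -> connect e2 (r, true) (w, s') = (s == s').
  move=> hw; have [<-//|ss] := eqVneq s s'.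
  apply/negP => hw'; have : connect e2 (w, s) (w, s').
    by apply: connect_trans hw'; rewrite e2_sym.
  have -> : s' = ~~ s by case: (s) (s') ss => [] [].
  by rewrite (negPf (tf _ _)).
by rewrite (decide _ _ _ ht) (decide _ _ _ hv); case: (t).
Qed.

End BipartiteGraphs.

(** * Weighted edge ideals and the bipartite case *)

Section WeightedEdgeIdeals.
Variables (K : fieldType) (n : nat).
Local Notation sset := (sset K n).
Implicit Types (A B : 'X_{1..n} -> Prop) (I J P Q : sset) (m u : 'X_{1..n}).
Implicit Types (f g : {mpoly K[n]}) (C : 'I_n -> Prop) (e : rel 'I_n) (d : 'I_n -> nat).

(** These are the exponents of the ideal generated by the [x_i^(d_i) x_j^(d_j)] over the edges;
    constant weight 1 gives the edge ideal. *)
Definition wedges e d m := exists i j, [/\ e i j, d i <= m i & d j <= m j]%N.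

Lemma up_wedges e d : up_closed (wedges e d).
Proof.
move=> m m' [i [j [eij di dj]]] mm'; exists i, j.
by split=> //; [apply: leq_trans (mm' i)|apply: leq_trans (mm' j)].
Qed.

(** For positive [d], the condition [s <= floor_deg d C m] says that [x^m] lies in the [s]-th power
    of the ideal of the [x_i^(d_i)], [i] in [C]. *)
Definition floor_deg d (C : {set 'I_n}) m := (\sum_(i in C) m i %/ d i)%N.

Lemma floor_deg_mdiv d (C : {set 'I_n}) m m' : mdiv m m' -> (floor_deg d C m <= floor_deg d C m')%N.
Proof. by move=> mm'; apply: leq_sum => i _; apply: leq_div2r. Qed.

Lemma floor_degD d (C : {set 'I_n}) m u :
  (floor_deg d C m + floor_deg d C u <= floor_deg d C (m + u)%MM)%N.
Proof.
rewrite -big_split; apply: leq_sum => i _ /=; rewrite mnmDE.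
by case: (posnP (d i)) => [->|d0]; rewrite ?divn0 // divnD // leq_addr.
Qed.

Lemma floor_deg_mprod A d (C : {set 'I_n}) k s m :
  (forall u, A u -> (k <= floor_deg d C u)%N) -> mprod_above A s m ->
  (k * s <= floor_deg d C m)%N.
Proof.
move=> hA [l [<- hl lm]]; apply: leq_trans (floor_deg_mdiv d C lm).
elim: l hl {lm} => [|u l IHl] hl /=; first by rewrite muln0.
rewrite big_cons mulnS; apply: leq_trans (floor_degD _ _ _ _).
apply: leq_add; first by apply/hA/hl; rewrite inE eqxx.
by apply: IHl => v vl; apply: hl; rewrite inE vl orbT.
Qed.

Lemma exprD_mod f g k : exists h, (f + g) ^+ k = f * h + g ^+ k.
Proof.
elim: k => [|k [h eh]]; first by exists 0; rewrite mulr0 add0r.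
exists ((f + g) * h + g ^+ k); rewrite !exprS eh mulrDr mulrCA.
by rewrite [(f + g) * g ^+ k]mulrDl addrA -mulrDr.
Qed.

(** The hypotheses make the span of [A] behave as a primary ideal for [(C)]. Write [g = a + b] with
    [a] in [(C)] and [b] free of it: modulo [g], [b^k] is [(-a)^k], which lies in the span for large
    [k], so [b^k f] does too. Comparing leading monomials finishes. *)
Lemma mspan_contr A C f g : up_closed A ->
  (forall i, C i -> rad (mspan A) (mono K U_(i)%MM)) ->
  (forall m u, ~ meets C u -> A (u + m)%MM -> A m) ->
  ~ mspan (meets C) g -> mspan A (g * f) -> mspan A f.
Proof.
move=> upA radA satA nPg Agf; apply: NNPP => nAf.
have idA := @mspan_ideal K n A upA; have [_ AD AM] := idA.
have [a [b [gab Pa b0 hb]]] := mspan_rest nPg.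
have [a' [b' [fab Aa' b0' hb']]] := mspan_rest nAf.
have [k Ak] := mspan_meets_rad idA radA Pa.
have [h eh] := exprD_mod g (- a) k.
have eb : b = g + - a by rewrite gab addrC addKr.
have Abf : mspan A (b ^+ k * f).
  rewrite eb eh mulrDl; apply: AD.
    by rewrite mulrAC; apply: (idealMr _ idA).
  by apply: (idealMr _ idA); rewrite exprNn; apply: AM.
have Abb : mspan A (b ^+ k * b').
  have -> : b ^+ k * b' = b ^+ k * f + - (b ^+ k * a').
    by rewrite fab mulrDr addrC addKr.
  by apply: (AD) => //; apply: (idealN idA); apply: AM.
have bk0 : b ^+ k != 0 by rewrite expf_neq0.
have /Abb : mlead (b ^+ k * b') \in msupp (b ^+ k * b') by rewrite mlead_supp // mulf_neq0.
rewrite mleadM // mleadX // => /satA Ab'.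
case: (hb' _ (mlead_supp b0')) => _; apply; apply: Ab' => -[i [Ci]].
rewrite mulmnE muln_gt0 => /andP [bi _].
by case: (hb _ (mlead_supp b0)) => _; apply; exists i.
Qed.

(** By minimality each [i] in [C] has a neighbour [j] outside [C]. A prime between [I] and [(C)]
    contains [x_i^(d_i) x_j^(d_j)] but not [x_j], hence contains [x_i]. *)
Lemma min_cover_min_prime I e d (C : {set 'I_n}) :
  irreflexive e -> seqv I (mspan (wedges e d)) -> std_weighting d ->
  minset (vcover e) C -> min_prime I (mspan (meets (fun i => i \in C))).
Proof.
move=> irr_e IE d0 /minsetP [covC minC]; split; first exact: meets_prime.
  move=> f /IE hf m /hf [i [j [eij di dj]]].
  have [iC|jC] := orP (vcoverP _ _ covC i j eij); [exists i|exists j]; split=> //.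
    exact: leq_trans (d0 i) di.
  exact: leq_trans (d0 j) dj.
move=> Q prQ IQ QP f hf; have [idQ _ QM] := prQ.
apply: mspan_monomials_sub => // m /hf [i [iC mi]].
apply: (ideal_up_closed idQ) (proj2 (mdivU i m) mi).
have [j eij jC] : exists2 j, e i j || e j i & j \notin C.
  apply: NNPP => h.
  have nbr j : e i j || e j i -> j \in C :\ i.
    move=> eij; rewrite !inE; apply/andP; split.
      by apply: contraTneq eij => ->; rewrite irr_e.
    by apply: contraT => jC; case: h; exists j.
  have covD : vcover e (C :\ i).
    apply/vcoverP => u v euv; have [ui|ui] := eqVneq u i.
      by apply/orP; right; apply: nbr; rewrite -ui euv.
    have [vi|vi] := eqVneq v i.
      by apply/orP; left; apply: nbr; rewrite -vi euv orbT.
    by move/vcoverP: covC => /(_ u v euv); rewrite !inE ui vi.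
  by have := minC _ covD (subsetDl _ _) => /setP /(_ i); rewrite !inE eqxx iC.
have : Q ('X_[(U_(i) *+ d i)] * 'X_[(U_(j) *+ d j)]).
  rewrite -mpolyXD; apply/IQ/IE/mspanX.
  case/orP: eij => h; [exists i, j|exists j, i]; split=> //;
    by rewrite mnmDE !mulmnE !mnm1E eqxx mul1n ?leq_addr ?leq_addl.
rewrite -!mpolyXn => /QM [] /(prime_exp prQ) // /QP.
move=> /(_ U_(j)%MM); rewrite msuppX inE eqxx => /(_ isT) [k [kC]].
by rewrite mnm1E; case: eqP kC => [<-|//]; rewrite (negPf jC).
Qed.

Lemma bipartite_Simis I e d (col : 'I_n -> bool) :
  ssrbool.symmetric e -> (forall i j, e i j -> col i != col j) -> std_weighting d ->
  seqv I (mspan (wedges e d)) -> Simis I.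
Proof.
move=> sym_e hcol d0 IE s s1 f.
have irr_e : irreflexive e.
  by move=> i; apply/negP => /hcol; rewrite eqxx.
have powE := powI_monoE s (@up_wedges e d) IE.
split=> [symf|powf P [[_ P1 _] _ _]]; last by exists 1; rewrite mul1r.
apply/powE => m mf.
have hC (C : {set 'I_n}) : vcover e C -> (s <= \sum_(i in C) m i %/ d i)%N.
  move=> covC; have [C0 minC0 sC] := minset_exists covC.
  have covC0 := minsetp minC0.
  have minP := min_cover_min_prime irr_e IE d0 minC0.
  have [g [nPg /powE hgf]] := symf _ minP.
  apply: (@leq_trans (\sum_(i in C0) m i %/ d i)%N); last first.
    by rewrite [X in (_ <= X)%N](big_setID C0) /= (setIidPr sC) leq_addr.
  (* The power [(x_i^(d_i), i in C0)^s] contains [I^s], and contraction from the localization at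
     [(C0)] does not enlarge it. *)
  pose A u := (s <= floor_deg d C0 u)%N.
  have upA : up_closed A.
    by move=> u v Au uv; apply: leq_trans Au (floor_deg_mdiv _ _ uv).
  suff Af : mspan A f by apply: Af.
  apply: (mspan_contr upA _ _ nPg).
  - move=> i iC; exists (d i * s)%N; rewrite /mono mpolyXn; apply/mspanX; rewrite /A.
    rewrite /floor_deg (big_setD1 i iC) /= mulmnE mnm1E eqxx mul1n mulKn //.
    exact: leq_addr.
  - move=> v u nu; rewrite /A /floor_deg => h; apply: leq_trans h _.
    apply: leq_sum => i iC; rewrite mnmDE.
    suff -> : u i = 0%N by [].
    by apply/eqP; rewrite -leqn0 leqNgt; apply/negP => ui; apply: nu; exists i.
  - move=> v /hgf /(@floor_deg_mprod _ d C0 1); rewrite mul1n; apply.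
    move=> u [i [j [eij di dj]]].
    have [iC|jC] := orP (vcoverP _ _ covC0 i j eij).
      by rewrite /floor_deg (big_setD1 i iC) /= addn_gt0 divn_gt0 // di.
    by rewrite /floor_deg (big_setD1 j jC) /= addn_gt0 divn_gt0 // dj.
have [l [sl el ml]] := koenig_capacities sym_e hcol hC.
(* Each chosen edge becomes a generator; no vertex [v] is used more than [m v %/ d v] times, so the
   product divides [x^m]. *)
exists [seq (U_(p.1) *+ d p.1 + U_(p.2) *+ d p.2)%MM | p <- l]; split.
- by rewrite size_map.
- move=> u /mapP [p pl ->]; exists p.1, p.2; split; first exact: el.
    by rewrite mnmDE !mulmnE !mnm1E eqxx mul1n leq_addr.
  by rewrite mnmDE !mulmnE !mnm1E eqxx mul1n leq_addl.
- move=> v; rewrite mnm_sumE big_map.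
  apply: leq_trans (leq_divM (m v) (d v)); apply: leq_trans (leq_mul (ml v) (leqnn _)).
  rewrite big_distrl /=; apply: leq_sum => p _; rewrite mnmDE !mulmnE !mnm1E mulnDl.
  by apply: leq_add; case: eqP => // ->.
Qed.

(** A power of a polynomial has the same variables in its leading monomial as the polynomial itself,
    so the terms left after removing the edge ideal cannot have a power in [I]. *)
Lemma rad_edge_ideal I A e : up_closed A -> seqv I (mspan A) ->
  (forall m, A m -> exists i j, [/\ e i j, 0 < m i & 0 < m j]%N) ->
  (forall i j, e i j ->
     exists m, A m /\ forall k, k != i -> k != j -> m k = 0%N) ->
  seqv (rad I) (mspan (wedges e (fun=> 1%N))).
Proof.
move=> upA IA Ae eA f.
have idI : is_ideal I := proj1 (monomial_idealP (mspan_monomial upA IA)).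
have idW := @mspan_ideal K n _ (@up_wedges e (fun=> 1%N)); have [_ WD WM] := idW.
split=> [[k /IA Af]|hf].
  apply: NNPP => nWf; have [a [b [fab Wa b0 hb]]] := mspan_rest nWf.
  have [h eh] := exprD_mod (- a) f k.
  have eb : b = - a + f by rewrite fab addKr.
  have Wbk : mspan (wedges e (fun=> 1%N)) (b ^+ k).
    rewrite eb eh; apply: WD.
      by rewrite mulNr; apply: (idealN idW); apply: (idealMr _ idW).
    by move=> m /Af /Ae.
  have /Wbk : mlead (b ^+ k) \in msupp (b ^+ k) by rewrite mlead_supp // expf_neq0.
  rewrite mleadX // => -[i [j [eij]]]; rewrite !mulmnE !muln_gt0.
  move=> /andP [bi _] /andP [bj _].
  by case: (hb _ (mlead_supp b0)) => _; apply; exists i, j.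
apply: mspan_monomials_sub; first exact: rad_ideal.
move=> m /hf [i [j [/eA [m0 [Am0 supp0]] mi mj]]].
(* This power dominates both nonzero exponents of [m0]. *)
exists (m0 i + m0 j)%N; rewrite /mono mpolyXn; apply/IA/mspanX.
apply: upA Am0 _ => k; rewrite mulmnE.
have [->|ki] := eqVneq k i; first by apply: leq_trans (leq_pmull _ mi); apply: leq_addr.
have [->|kj] := eqVneq k j; first by apply: leq_trans (leq_pmull _ mj); apply: leq_addl.
by rewrite supp0.
Qed.

Lemma mingen_edge_ideal J e m : irreflexive e ->
  seqv J (mspan (wedges e (fun=> 1%N))) ->
  mingen J m <-> exists i j, e i j /\ m = (U_(i) + U_(j))%MM.
Proof.
move=> irr_e JE; have JX u : J (mono K u) <-> wedges e (fun=> 1%N) u.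
  by rewrite (JE _) mspanX.
have WU i j : e i j -> wedges e (fun=> 1%N) (U_(i) + U_(j))%MM.
  by move=> eij; exists i, j; rewrite !mnmDE !mnm1E !eqxx; split=> //; rewrite leq_addl.
split=> [[/JX [i [j [eij mi mj]]] minm]|[i [j [eij ->]]]].
  exists i, j; split=> //; symmetry; apply: minm; first by apply/JX/WU.
  have ij : i != j by apply: contraTneq eij => ->; rewrite irr_e.
  move=> k; rewrite mnmDE !mnm1E; have [<-|_] := eqVneq i k.
    by rewrite eq_sym (negPf ij).
  by have [<-|] := eqVneq j k.
split; first by apply/JX/WU.
move=> u /JX [k [l [ekl uk ul]]] um.
have kl : k != l by apply: contraTneq ekl => ->; rewrite irr_e.
have ij : i != j by apply: contraTneq eij => ->; rewrite irr_e.
have kij x : (0 < u x)%N -> (x == i) || (x == j).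
  move=> ux; have := leq_trans ux (um x); rewrite mnmDE !mnm1E ![_ == x]eq_sym.
  by case: (x == i); case: (x == j).
have uij x : (x == i) || (x == j) -> (0 < u x)%N.
  move: (kij _ uk) (kij _ ul) => /orP [] /eqP ek /orP [] /eqP el /orP [] /eqP ->;
  by rewrite -?ek -?el // in kl *; move: kl; rewrite ?ek ?el ?eqxx.
apply/mnmP => x; apply/eqP; rewrite eqn_leq um /= mnmDE !mnm1E.
have := uij x; rewrite ![x == _]eq_sym; have [<-|_] := eqVneq i x.
  by rewrite eq_sym (negPf ij) => ->.
by have [<- ->|] := eqVneq j x.
Qed.

Lemma weighted_edge_ideal J e d : irreflexive e ->
  seqv J (mspan (wedges e (fun=> 1%N))) ->
  seqv (weighted J d) (mspan (wedges e d)).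
Proof.
move=> irr_e JE f.
have eqw i j k : weight d (U_(i) + U_(j))%MM k = (d k * ((i == k) + (j == k)))%N.
  by rewrite mnmE mnmDE !mnm1E.
pose B m := exists u, mingen J u /\ m = weight d u.
have BE m : above B m <-> wedges e d m.
  split=> [[_ [[_ [/(mingen_edge_ideal _ irr_e JE) [i [j [eij ->]]] ->]] um]]|].
    exists i, j; split=> //.
      by apply: leq_trans (um i); rewrite eqw eqxx leq_pmulr.
    by apply: leq_trans (um j); rewrite eqw eqxx leq_pmulr // addn1.
  move=> [i [j [eij di dj]]]; exists (weight d (U_(i) + U_(j))%MM); split.
    exists (U_(i) + U_(j))%MM; split=> //.
    by apply/(mingen_edge_ideal _ irr_e JE); exists i, j.
  have ij : i != j by apply: contraTneq eij => ->; rewrite irr_e.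
  move=> k; rewrite eqw; have [<-|_] := eqVneq i k.
    by rewrite eq_sym (negPf ij) muln1.
  by have [<-|] := eqVneq j k; rewrite ?muln1 ?muln0.
split.
  apply: (genI_min (@mspan_ideal K n _ (@up_wedges e d))) => _ [u [mu ->]].
  apply/mspanX/BE; exists (weight d u); split; last exact: mdiv_refl.
  by exists u.
move=> hf; apply: mspan_monomials_sub; first exact: genI_ideal.
move=> m /hf /BE [_ [[u [mu ->]] um]].
apply: (ideal_up_closed (genI_ideal _)) um; apply: genI_mem; by exists u.
Qed.

Lemma mingen_below I m : I (mono K m) -> exists u, mingen I u /\ mdiv u m.
Proof.
have [N] := ubnP (mdeg m); elim: N m => // N IHN m ltN Im.
have [h|h] := classic (mingen I m); first by exists m; split=> //; apply: mdiv_refl.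
have [u [Iu um neq]] : exists u, [/\ I (mono K u), mdiv u m & u <> m].
  apply: NNPP => h'; apply: h; split=> // u Iu um; apply: NNPP => neq.
  by apply: h'; exists u.
have [|v [mv vu]] := IHN u _ Iu; last by exists v; split=> //; apply: mdiv_trans um.
rewrite ltnS in ltN; apply: leq_trans ltN.
rewrite (mdiv_subK um) mdegD -[X in (X < _)%N]add0n ltn_add2r lt0n mdeg_eq0.
by apply/eqP => h0; apply: neq; rewrite [RHS](mdiv_subK um) h0 add0m.
Qed.

End WeightedEdgeIdeals.

(** * Exponents of the generators of a Simis ideal *)

Section SimisMonomials.
Variables (n : nat) (T : Type).
(* [A] stands for the monomials of an ideal with minimal generators [G], and
   [q k] for those of its irreducible components. *)
Variables (A G : 'X_{1..n} -> Prop) (q : T -> 'X_{1..n} -> Prop).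
Hypothesis upA : up_closed A.
Hypothesis GA : forall g, G g -> A g.
Hypothesis G_below : forall m, A m -> exists g, G g /\ mdiv g m.
Hypothesis G_anti : forall g g', G g -> G g' -> mdiv g g' -> g = g'.
Hypothesis G_edge : forall g, G g -> exists i j,
  [/\ i != j, 0 < g i, 0 < g j & forall k, k != i -> k != j -> g k = 0]%N.
Hypothesis qA : forall k m, A m -> q k m.
Hypothesis q_pure : forall k m, q k m ->
  exists i, (0 < m i)%N /\ q k (U_(i) *+ m i)%MM.
Hypothesis simis : forall s m, (0 < s)%N ->
  (forall k, mprod_above (q k) s m) -> mprod_above A s m.
Local Open Scope nat_scope.
Implicit Types (m g h : 'X_{1..n}) (i j a b c : 'I_n).

Definition on_edge m i j :=
  [/\ i != j, 0 < m i, 0 < m j & forall k, k != i -> k != j -> m k = 0].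

Lemma on_edge_sym m i j : on_edge m i j -> on_edge m j i.
Proof. by case=> ij mi mj h; split=> [|//|//|k ? ?]; [rewrite eq_sym|apply: h]. Qed.

Lemma on_edge_supp m i j k : on_edge m i j -> 0 < m k -> k = i \/ k = j.
Proof.
case=> _ _ _ h mk; have [->|ki] := eqVneq k i; first by left.
by have [->|kj] := eqVneq k j; [right|rewrite h in mk].
Qed.

Lemma mdeg_on_edge m i j : on_edge m i j -> mdeg m = m i + m j.
Proof.
case=> ij _ _ h; rewrite mdegE (bigD1 i) //= (bigD1 j) 1?eq_sym //=.
by rewrite big1 ?addn0 // => k /andP [ki kj]; apply: h.
Qed.

Lemma mprod_above2 (B : 'X_{1..n} -> Prop) m h h' :
  B h -> B h' -> mdiv (h + h')%MM m -> mprod_above B 2 m.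
Proof.
move=> Bh Bh' hm; exists [:: h; h']; split=> //; last by rewrite big_cons big_seq1.
by move=> u; rewrite !inE => /orP [] /eqP ->.
Qed.

Lemma simis2 m : (forall k, mprod_above (q k) 2 m) ->
  exists h h', [/\ G h, G h' & forall i, h i + h' i <= m i].
Proof.
move=> /(simis (ltn0Sn 1)) [l [sl hl lm]].
case: l sl hl lm => [|u [|v [|]]] // _ hl lm.
have [h [Gh hu]] : exists h, G h /\ mdiv h u by apply/G_below/hl; rewrite inE eqxx.
have [h' [Gh' hv]] : exists h, G h /\ mdiv h v.
  by apply/G_below/hl; rewrite !inE eqxx orbT.
exists h, h'; split=> // i; have := lm i; rewrite big_cons big_seq1 mnmDE.
by apply: leq_trans; apply: leq_add.
Qed.

Lemma q_edge k g i j : G g -> on_edge g i j ->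
  q k (U_(i) *+ g i)%MM \/ q k (U_(j) *+ g j)%MM.
Proof.
move=> Gg gij; have [x [gx qx]] := q_pure (qA k (GA Gg)).
by case: (on_edge_supp gij gx) => <-; [left|right].
Qed.

Lemma mulUE i k x : (U_(i) *+ k)%MM x = (i == x) * k.
Proof. by rewrite mulmnE mnm1E. Qed.

(* For two generators on one edge, [g g' / (x_i x_j)] lies in the second symbolic
   power; two generators dividing it yield a pair of smaller degree. *)
Lemma edge_gen_unique g g' i j :
  G g -> G g' -> on_edge g i j -> on_edge g' i j -> g = g'.
Proof.
have [N] := ubnP (mdeg g + mdeg g'); elim: N g g' => // N IHN g g' ltN Gg Gg' gij g'ij.
wlog lti : g g' ltN Gg Gg' gij g'ij / g i < g' i.
  move=> H; case: (ltngtP (g i) (g' i)) => [lt|gt|eqi]; first exact: H.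
    by symmetry; apply: H => //; rewrite addnC.
  have cmp (u v : 'X_{1..n}) : on_edge u i j -> u i = v i -> u j <= v j -> mdiv u v.
    move=> [_ _ _ u0] ui uj x; have [->|xi] := eqVneq x i; first by rewrite ui.
    by have [->//|xj] := eqVneq x j; rewrite u0.
  by have [le|/ltnW le] := leqP (g j) (g' j); [|symmetry]; apply: G_anti => //; apply: cmp.
have [ij gi gj g0] := gij; have [_ g'i g'j g0'] := g'ij.
have ltj : g' j < g j.
  rewrite ltnNge; apply/negP => le; suff gg' : g = g' by rewrite gg' ltnn in lti.
  apply: G_anti => // x; have [->|xi] := eqVneq x i; first exact: ltnW.
  by have [->//|xj] := eqVneq x j; rewrite g0.
(* A component contains [x_i^(g i)], or else both [x_j^(g j)] and one of [x_i^(g' i)], [x_j^(g' j)];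
   each case supplies two pure powers whose product divides. *)
have [k|h [h' [Gh Gh' hM]]] := @simis2 (g + g' - (U_(i) + U_(j)))%MM.
  have [qi|qj] := q_edge k Gg gij.
    apply: (mprod_above2 qi qi) => x; rewrite !mnmDE mnmBE !mnmDE !mulUE !mnm1E.
    have [<-|_] := eqVneq i x; last by rewrite !mul0n.
    by rewrite eq_sym (negPf ij); move: lti gi; clear; lia.
  have [qi'|qj'] := q_edge k Gg' g'ij.
    apply: (mprod_above2 qi' qj) => x; rewrite !mnmDE mnmBE !mnmDE !mulUE !mnm1E.
    have [<-|_] := eqVneq i x.
      by rewrite eq_sym (negPf ij); move: gi; clear; lia.
    have [<-|_] := eqVneq j x; last by rewrite !mul0n.
    by move: g'j; clear; lia.
  apply: (mprod_above2 qj' qj') => x; rewrite !mnmDE mnmBE !mnmDE !mulUE !mnm1E.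
  have [<-|_] := eqVneq j x; last by rewrite !mul0n.
  by rewrite (negPf ij); move: ltj g'j; clear; lia.
have hi : h i + h' i < g i + g' i.
  by have := hM i; rewrite mnmBE !mnmDE !mnm1E eqxx; move: gi; clear; lia.
have hj : h j + h' j < g j + g' j.
  by have := hM j; rewrite mnmBE !mnmDE !mnm1E eqxx; move: gj; clear; lia.
have edge u : G u -> (forall x, u x <= h x + h' x) -> on_edge u i j.
  move=> Gu uh; have [a [b [ab ua ub u0]]] := G_edge Gu.
  have sup x : 0 < u x -> x = i \/ x = j.
    move=> ux; have := leq_trans ux (leq_trans (uh x) (hM x)).
    rewrite mnmBE !mnmDE; have [->|xi] := eqVneq x i; first by left.
    by have [->|xj] := eqVneq x j; [right|rewrite g0 // g0'].
  have [sa sb] := (sup a ua, sup b ub); move: ab ua ub u0.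
  case: sa => ->; case: sb => ->; rewrite ?eqxx //.
  by move=> ab ua ub u0; apply/on_edge_sym; split.
have hij : on_edge h i j by apply: edge => // x; apply: leq_addr.
have h'ij : on_edge h' i j by apply: edge => // x; apply: leq_addl.
move: ltN; rewrite (mdeg_on_edge gij) (mdeg_on_edge g'ij) => ltN.
have IH u v : G u -> G v -> on_edge u i j -> on_edge v i j ->
    u i + u j + (v i + v j) < g i + g j + (g' i + g' j) -> u = v.
  move=> Gu Gv uij vij lt; apply: IHN => //.
  by rewrite (mdeg_on_edge uij) (mdeg_on_edge vij); apply: leq_trans lt _.
(* Both exponents of the pair drop, so induction gives [h = h']. Then [h] has smaller degree than
   the larger of [g], [g'], so it equals the other one, which contradicts [hi] or [hj]. *)
have hh' : h = h' by apply: IH => //; move: hi hj; clear; lia.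
rewrite -hh' in hi hj; have [le|lt] := leqP (g' i + g' j) (g i + g j).
  have hg : h = g' by apply: IH => //; move: hi hj le; clear; lia.
  by rewrite hg in hi; move: lti hi; clear; lia.
have hg : g = h by apply: IH => //; move: hi hj lt; clear; lia.
by rewrite -hg in hj; move: ltj hj; clear; lia.
Qed.

(** The monomial [g g' / x_a] lies in the second symbolic power, hence above two generators
    supported in the triangle [a, b, c]. The exponent bounds at [a], [b], [c] exclude [g] and [g'],
    so both are the unique generator on [bc]. *)
Lemma adjacent_gens_lt g g' a b c :
  G g -> G g' -> on_edge g a b -> on_edge g' a c -> b != c -> g a < g' a ->
  exists h, [/\ G h, on_edge h b c, 2 * h b <= g b & 2 * h c <= g' c].
Proof.
move=> Gg Gg' gab g'ac bc lta.
have [ab ga gb g0] := gab; have [ac g'a g'c g0'] := g'ac.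
have [ba ca cb] : [/\ b != a, c != a & c != b] by rewrite ![_ == a]eq_sym ab ac eq_sym.
have [k|h [h' [Gh Gh' hM]]] := @simis2 (g + g' - U_(a))%MM.
  have [qa|qb] := q_edge k Gg gab.
    apply: (mprod_above2 qa qa) => x; rewrite !mnmDE mnmBE !mnmDE !mulUE !mnm1E.
    by have [<-|_] := eqVneq a x; [move: lta; clear; lia|rewrite !mul0n].
  have [qa'|qc'] := q_edge k Gg' g'ac.
    apply: (mprod_above2 qa' qb) => x; rewrite !mnmDE mnmBE !mnmDE !mulUE !mnm1E.
    have [<-|_] := eqVneq a x; first by rewrite (negPf ba); move: ga; clear; lia.
    by have [<-|_] := eqVneq b x; [clear; lia|rewrite !mul0n].
  apply: (mprod_above2 qb qc') => x; rewrite !mnmDE mnmBE !mnmDE !mulUE !mnm1E.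
  have [<-|_] := eqVneq b x.
    by rewrite (negPf cb) eq_sym (negPf ba); clear; lia.
  have [<-|_] := eqVneq c x; last by rewrite !mul0n.
  by rewrite (negPf ac); clear; lia.
have ha : h a + h' a < g a + g' a.
  by have := hM a; rewrite mnmBE !mnmDE !mnm1E eqxx; move: ga; clear; lia.
have hb : h b + h' b <= g b.
  by have := hM b; rewrite mnmBE !mnmDE !mnm1E (negPf ab) (g0' b) // subn0 addn0.
have hc : h c + h' c <= g' c.
  by have := hM c; rewrite mnmBE !mnmDE !mnm1E (negPf ac) (g0 c) // subn0.
have edge u : G u -> (forall x, u x <= h x + h' x) -> [\/ u = g, u = g' | on_edge u b c].
  move=> Gu uh; have [x [y uxy]] := G_edge Gu; rewrite -/(on_edge u x y) in uxy.
  have sup z : 0 < u z -> [\/ z = a, z = b | z = c].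
    move=> uz; have := leq_trans uz (leq_trans (uh z) (hM z)); rewrite mnmBE !mnmDE.
    have [->|za] := eqVneq z a; first by constructor 1.
    have [->|zb] := eqVneq z b; first by constructor 2.
    by have [->|zc] := eqVneq z c; [constructor 3|rewrite g0 // g0'].
  have [xy ux uy _] := uxy; move: xy uxy.
  case: (sup x ux) => ->; case: (sup y uy) => ->; rewrite ?eqxx // => _ uxy.
  - by constructor 1; apply: edge_gen_unique uxy gab.
  - by constructor 2; apply: edge_gen_unique uxy g'ac.
  - by constructor 1; apply: edge_gen_unique (on_edge_sym uxy) gab.
  - by constructor 3.
  - by constructor 2; apply: edge_gen_unique (on_edge_sym uxy) g'ac.
  - by constructor 3; apply: on_edge_sym.
have [eh eh'] : [\/ h = g, h = g' | on_edge h b c] /\ [\/ h' = g, h' = g' | on_edge h' b c].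
  by split; apply: edge => // x; rewrite ?leq_addl ?leq_addr.
case: eh => [eh|eh|hbc]; case: eh' => [eh'|eh'|h'bc].
- by move: hb gb; rewrite eh eh'; clear; lia.
- by move: ha; rewrite eh eh' ltnn.
- by case: h'bc => _ h'b _ _; move: hb h'b; rewrite eh; clear; lia.
- by move: ha; rewrite eh eh' addnC ltnn.
- by move: hc g'c; rewrite eh eh'; clear; lia.
- by case: h'bc => _ _ h'c _; move: hc h'c; rewrite eh; clear; lia.
- by case: hbc => _ h'b _ _; move: hb h'b; rewrite eh'; clear; lia.
- by case: hbc => _ _ h'c _; move: hc h'c; rewrite eh'; clear; lia.
have hh : h = h' by apply: edge_gen_unique hbc h'bc.
by exists h; split=> //; [move: hb|move: hc]; rewrite -hh mul2n addnn.
Qed.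

Lemma adjacent_gens_neq g g' a b c :
  G g -> G g' -> on_edge g a b -> on_edge g' a c -> b != c -> g a != g' a ->
  exists h, [/\ G h, on_edge h b c, 2 * h b <= g b & 2 * h c <= g' c].
Proof.
move=> Gg Gg' gab g'ac bc; case: ltngtP => // lt _; first exact: adjacent_gens_lt lt.
rewrite eq_sym in bc; have [h [Gh hcb h1 h2]] := adjacent_gens_lt Gg' Gg g'ac gab bc lt.
by exists h; split=> //; apply: on_edge_sym.
Qed.

(* A mismatch at [a] forces a generator [h] on [bc] with small exponents; this is
   again a mismatch at [b], and the exponents at [c] then shrink around the triangle. *)
Lemma gen_exponent_unique g g' a b c :
  G g -> G g' -> on_edge g a b -> on_edge g' a c -> g a = g' a.
Proof.
move=> Gg Gg' gab g'ac; have [bc|bc] := eqVneq b c.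
  by rewrite bc in gab; rewrite (edge_gen_unique Gg Gg' gab g'ac).
apply/eqP; apply: contraT => neq.
have [h [Gh hbc hb hc]] := adjacent_gens_neq Gg Gg' gab g'ac bc neq.
have [_ _ gb _] := gab; have [ac _ g'c _] := g'ac; have [_ hb0 _ _] := hbc.
have neqb : g b != h b.
  by apply/eqP => e; rewrite e in hb; move: hb hb0; clear; lia.
(* By uniqueness on [ac], [h2] is [g'], so that [4 * g' c <= g' c]. *)
have [h2 [Gh2 h2ac _ h2c]] := adjacent_gens_neq Gg Gh (on_edge_sym gab) hbc ac neqb.
move: h2c hc g'c; rewrite (edge_gen_unique Gh2 Gg' h2ac g'ac); clear; lia.
Qed.

Lemma gen_exponents : exists d : 'I_n -> nat,
  std_weighting d /\ forall g i, G g -> 0 < g i -> g i = d i.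
Proof.
suff /fin_all_exists [d hd] : forall i, exists v,
    0 < v /\ forall g, G g -> 0 < g i -> g i = v.
  by exists d; split=> [i|g i]; case: (hd i) => // _; apply.
move=> i; have [[g [Gg gi]]|h] := classic (exists g, G g /\ 0 < g i); last first.
  (* A variable in no generator gets weight 1, as weights must be positive. *)
  by exists 1; split=> // g Gg gi; case: h; exists g.
have edge u : G u -> 0 < u i -> exists b, on_edge u i b.
  move=> Gu ui; have [x [y uxy]] := G_edge Gu.
  by case: (on_edge_supp uxy ui) => ->; [exists y|exists x; apply: on_edge_sym].
exists (g i); split=> // g' Gg' g'i.
have [b gb] := edge _ Gg gi; have [c g'c] := edge _ Gg' g'i.
exact: gen_exponent_unique g'c gb.
Qed.

Lemma simis_weighted_bipartite (e : rel 'I_n) :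
  (forall i j, e i j <-> exists g, G g /\ on_edge g i j) ->
  (exists col : 'I_n -> bool, forall i j, e i j -> col i != col j) /\
  exists d, std_weighting d /\ forall m, A m <-> wedges e d m.
Proof.
move=> eE; have [d [d0 Gd]] := gen_exponents.
have AE m : A m <-> wedges e d m.
  split=> [/G_below [g [Gg gm]]|[i [j [/eE [g [Gg gij]] di dj]]]].
    have [i [j gij]] := G_edge Gg; have [_ gi gj _] := gij.
    by exists i, j; split; [apply/eE; exists g|rewrite -(Gd g)..].
  have [_ gi gj g0] := gij; apply: (upA (GA Gg)) => x.
  have [->|xi] := eqVneq x i; first by rewrite (Gd g).
  by have [->|xj] := eqVneq x j; [rewrite (Gd g)|rewrite g0].
split; last by exists d.
have e_sym : ssrbool.symmetric e.
  by move=> i j; apply/idP/idP => /eE [g [Gg gij]]; apply/eE; exists g; split=> //;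
    apply: on_edge_sym.
have [//|[x [p [px lx oddp]]]] := bipartite_or_odd_walk e_sym.
(* The walk is closed, so [p], which omits the starting point, lists each visit once. With
   [size p = 2r + 1], [s] is [r + 1]. *)
pose M := (\sum_(v <- p) U_(v) *+ d v)%MM; pose s := (size p)./2.+1.
have sizep : size p = 1 + (size p)./2 * 2.
  by rewrite -{1}[size p]odd_double_half oddp muln2.
have qM k : mprod_above (q k) s M.
  (* The variables with [x_v^(d_v)] in the component form a vertex cover, which the walk visits at
     least [s] times. *)
  have [c cE] : exists c : 'I_n -> bool, forall v, c v <-> q k (U_(v) *+ d v)%MM.
    suff /fin_all_exists [c cE] : forall v, exists b : bool, b <-> q k (U_(v) *+ d v)%MM.
      by exists c.
    by move=> v; have [h|h] := classic (q k (U_(v) *+ d v)%MM); [exists true|exists false].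
  have hc u v : e u v -> c u || c v.
    move=> /eE [g [Gg guv]]; have [_ gu gv _] := guv.
    case: (q_edge k Gg guv); rewrite (Gd g) // => /cE -> //.
    by rewrite orbT.
  have le : size p <= 2 * @count 'I_n c p.
    by have := path_vcover hc px; rewrite lx leq_add2r.
  apply: (@mprod_above_leq _ _ _ (@count 'I_n c p)).
    by rewrite /s; move: le sizep; clear; lia.
  exists [seq (U_(v) *+ d v)%MM | v <- p & c v]; split.
  - by rewrite size_map size_filter.
  - by move=> u /mapP [v]; rewrite mem_filter => /andP [/cE cv _ ->].
  - move=> i; rewrite !mnm_sumE big_map big_filter [X in _ <= X](bigID c) /=.
    exact: leq_addr.
(* Over all vertices every element of [A] has [floor_deg] at least 2, so the [s]-th power needs
   [2r + 2], whereas [M] has only [2r + 1]. *)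
have := @floor_deg_mprod n A d [set: 'I_n] 2 s M _ (simis (ltn0Sn _) qM).
have -> : floor_deg d [set: 'I_n] M = size p.
  rewrite -sum1_size (eq_bigr (fun v => \sum_i (v == i))); last first.
    move=> v _; rewrite (bigD1 v) //= eqxx big1 // => i.
    by rewrite eq_sym => /negPf ->.
  rewrite exchange_big /floor_deg (eq_bigl xpredT) => [|i]; last by rewrite inE.
  apply: eq_bigr => i _; rewrite mnm_sumE -[RHS](mulnK _ (d0 i)) big_distrl /=.
  congr (_ %/ _); apply: eq_bigr => v _; rewrite mulUE.
  by case: eqP => // ->.
move=> H.
suff /H : forall u, A u -> 2 <= floor_deg d [set: 'I_n] u.
  by move: sizep; rewrite /s; clear; lia.
move=> u /AE [i [j [/eE [g [_ [ij _ _ _]]] di dj]]].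
rewrite /floor_deg (big_setD1 i) ?inE //= (big_setD1 j) ?inE ?andbT 1?eq_sym //=.
have hi : 0 < u i %/ d i by rewrite divn_gt0.
have hj : 0 < u j %/ d j by rewrite divn_gt0.
by rewrite addnA; apply: leq_trans (leq_addr _ _); apply: (@leq_add 1 1).
Qed.

End SimisMonomials.

(** * The equivalence for support-2 ideals *)

Lemma on_edge_supp2 n (m : 'X_{1..n}) i j :
  on_edge m i j <-> supp2 m i j \/ supp2 m j i.
Proof.
split=> [[ij mi mj h]|].
  case: (ltngtP i j) => [lt|lt|/val_inj eij]; [left|right|].
  - by split.
  - by split=> // k ki kj; apply: h.
  - by rewrite eij eqxx in ij.
by case=> -[lt mi mj h]; split=> //; [|rewrite eq_sym| move=> k ki kj; apply: h];
  rewrite // neq_ltn lt.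
Qed.

Lemma Simis_weighted_bipartite (K : fieldType) (n : nat) (I : sset K n) (e : rel 'I_n) :
  support2_ideal I -> minimal_irr_decomposition I ->
  (forall i j, e i j <-> edgeG I i j) -> Simis I ->
  (exists col : 'I_n -> bool, forall i j, e i j -> col i != col j) /\
  exists d, std_weighting d /\ seqv I (mspan (wedges e d)).
Proof.
move=> [mI supp2I] [Qs [dec radQ]] eE simI.
have [idI IE] := monomial_idealP mI; have [irrQ IQ _] := dec.
have upA := ideal_up_closed idI.
suff [hcol [d [d0 AE]]] : (exists col : 'I_n -> bool, forall i j, e i j -> col i != col j) /\
    exists d, std_weighting d /\ forall m, monomials I m <-> wedges e d m.
  split=> //; exists d; split=> // f; split=> [/IE hf m /hf /AE //|hf].
  by apply/IE => m /hf /AE.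
apply: (@simis_weighted_bipartite n 'I_(size Qs) (monomials I) (mingen I)
  (fun k => monomials (nth (fun _ => True) Qs k))) => //.
- by move=> g [].
- by move=> m; apply: mingen_below.
- by move=> g g' [Ig _] [_ min'] gg'; apply: min'.
- move=> g /supp2I [i [j h]]; exists i, j.
  by apply/on_edge_supp2; left.
- by move=> k m /IQ; apply.
- move=> k m qm; have [irk mk] := irrQ k (ltn_ord k).
  exact: irreducible_pure_power qm.
- move=> s m s0 hq.
  have /(simI s s0) : symb_pow I s (mono K m).
    apply: symb_pow_mono dec radQ _ => k ks; exact: (hq (Ordinal ks)).
  by move=> /(powI_monoE s upA IE) /mspanX.
- move=> i j; rewrite eE; split=> -[g [Gg h]]; exists g; split=> //; exact/on_edge_supp2.
Qed.

Theorem theorem2p3 (K : fieldType) (n : nat) (I : sset K n) :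
  support2_ideal I ->
  minimal_irr_decomposition I ->
  no_embedded_primes I ->
  (Simis I <-> bipartite (edgeG I) /\ has_std_lin_weighting I) /\
  (Simis I ->
     exists (J : sset K n) (d : 'I_n -> nat),
       [/\ squarefree_monomial_ideal J, Simis J, std_weighting d &
           seqv I (weighted J d)]).
Proof.
move=> supI decI _; have [mI supp2I] := supI.
have [idI IE] := monomial_idealP mI; have upA := ideal_up_closed idI.
have [e eE] : exists e : rel 'I_n, forall i j, e i j <-> edgeG I i j.
  suff /fin_all_exists [b hb] : forall p : 'I_n * 'I_n,
      exists b : bool, b <-> edgeG I p.1 p.2.
    by exists (fun i j => b (i, j)) => i j; apply: (hb (i, j)).
  by move=> p; have [h|h] := classic (edgeG I p.1 p.2); [exists true|exists false].
have e_on i j : e i j <-> exists g, mingen I g /\ on_edge g i j.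
  by rewrite eE; split=> -[g [Gg h]]; exists g; split=> //; apply/on_edge_supp2.
have sym_e : ssrbool.symmetric e.
  by move=> i j; apply/idP/idP => /e_on [g [Gg h]]; apply/e_on; exists g; split=> //;
    apply: on_edge_sym.
have irr_e : irreflexive e.
  by move=> i; apply/negP => /e_on [g [_ [/eqP]]].
have radE : seqv (rad I) (mspan (wedges e (fun=> 1%N))).
  apply: (rad_edge_ideal upA IE) => [m /mingen_below [g [Gg gm]]|i j /e_on [g [[Ig _] [_ _ _ h]]]].
    have [i [j h]] := supp2I _ Gg; have [_ gi gj _] := h.
    exists i, j; split; [|exact: leq_trans (gm i)|exact: leq_trans (gm j)].
    by apply/e_on; exists g; split=> //; apply/on_edge_supp2; left.
  by exists g.
have weightE d := weighted_edge_ideal d irr_e radE.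
have fwd := Simis_weighted_bipartite supI decI eE.
split; [split=> [/fwd [[col hcol] [d [d0 Id]]]|[[col hcol] [d [d0 Id]]]]|].
- split; first by exists col => i j /eE /hcol.
  by exists d; split=> // f; rewrite (Id f) (weightE d f).
- apply: (bipartite_Simis sym_e (col := col) _ d0) => [i j /eE /hcol //|f].
  by rewrite (Id f) (weightE d f).
(* The square-free ideal is the radical: it is the edge ideal of the same bipartite graph, hence
   Simis by the converse with all weights 1. *)
- move=> /fwd [[col hcol] [d [d0 Id]]]; exists (rad I), d; split=> //.
  + split; first exact: mspan_monomial (@up_wedges _ _ _) radE.
    move=> m /(mingen_edge_ideal _ irr_e radE) [i [j [eij ->]]] k.
    rewrite mnmDE !mnm1E; case: eqP => [<-|_]; last by case: eqP.
    by case: eqP eij => // ->; rewrite irr_e.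
  + exact: (bipartite_Simis sym_e hcol _ radE).
  + by move=> f; rewrite (Id f) (weightE d f).
Qed.
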